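(* Let $\Gamma$ be a nonnegative ribbon graph of a connected trivalent graph $G$ with trivial automorphism group. After bifurcating all ribbon graphs of $G$ (up to equivalence) into even or odd with respect to $\Gamma$, the Penrose polynomial of the graph $G$, evaluated at $n\in\mathbb{N}$, is $$P(G,n) = \#\{n\text{-face colorings of all even ribbon graphs with respect to }\Gamma\} - \#\{n\text{-face colorings of all odd ribbon graphs with respect to }\Gamma\}.$$ Furthermore, if $G$ is planar, then $P(G,n)$ is the total number of $n$-face colorings on all ribbon graphs of $G$.
   Context: Graphs are finite multigraphs. A ribbon graph $\Gamma$ of a connected graph $G(V,E)$ is a compact surface with boundary containing $G$ (as a 1-dimensional CW complex) that deformation retracts onto $G$; equivalently one disk per vertex and one band per edge (orientable or not). $\overline\Gamma$ is the closed surface obtained by gluing a disk (face) to each boundary component. Two ribbon graphs are equivalent if there is a homeomorphism of the closed surfaces inducing an isomorphism of the underlying graphs; ''all ribbon graphs of $G$'' means all equivalence classes, each counted once. An $n$-face coloring of $\Gamma$ assigns one of $n$ colors to each face of $\overline\Gamma$ so that the faces on the two sides of every edge have different colors (none exists if some edge has the same face on both sides). Penrose polynomial of a ribbon graph: for $E=\{e_1,\dots,e_\ell\}$ and $\alpha\in\{0,1\}^\ell$ let $\Gamma_\alpha$ be the ribbon graph obtained from $\Gamma$ by inserting a half-twist in the band of $e_i$ for each $i$ with $\alpha_i=1$, let $k_\alpha$ be its number of boundary circles and $|\alpha|=\sum\alpha_i$. Then $P(\Gamma,n)=\sum_{\alpha}(-1)^{|\alpha|}n^{k_\alpha}$. A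 ribbon graph $\Gamma$ of a connected trivalent graph $G$ is positive (negative) if $P(\Gamma,n)$ is a nonzero polynomial with positive (negative) leading coefficient, and zero if $P(\Gamma,n)$ is identically zero; nonnegative means positive or zero. The polynomials $P(\Gamma,n)$ of all ribbon graphs of a connected trivalent $G$ agree up to sign, and the Penrose polynomial of $G$ is $P(G,n):=P(\Gamma,n)$ for any nonnegative ribbon graph $\Gamma$ of $G$. A ribbon graph of $G$ is even with respect to $\Gamma$ if it becomes equivalent to $\Gamma$ after inserting an even number of half-twists into (the bands of) some or all of its edges, and odd otherwise. *)

(* Defs.v *)
From HB Require Import structures.
From mathcomp Require Import all_boot all_order all_fingroup all_algebra.

Set Implicit Arguments.
Unset Strict Implicit.
Unset Printing Implicit Defensive.

Import GRing.Theory.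
Local Open Scope ring_scope.

(* Finite multigraphs; loops and parallel edges are allowed.  The order of the
   two ends of an edge only serves to name its two half-edges [(e, b)]. *)
Record mgraph := MGraph {
  vertex : finType;
  edge : finType;
  endpoint : edge -> bool -> vertex
}.

Definition half (G : mgraph) : finType := (edge G * bool)%type.

Definition star (G : mgraph) (v : vertex G) : {set half G} :=
  [set h : half G | endpoint h.1 h.2 == v].

Definition adjacent (G : mgraph) : rel (vertex G) :=
  fun u v => [exists h : half G,
    (endpoint h.1 h.2 == u) && (endpoint h.1 (~~ h.2) == v)].

Definition connected (G : mgraph) : Prop :=
  (0 < #|vertex G|)%N /\ forall u v : vertex G, connect (@adjacent G) u v.

Definition trivalent (G : mgraph) : Prop :=
  forall v : vertex G, #|star v| = 3%N.

(* Pairs of bijections (on vertices, on edges) preserving incidence; an edge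
   may be mapped to its image with either matching of the ends. *)
Definition automorphisms (G : mgraph) :
    {set {perm vertex G} * {perm edge G}} :=
  [set fg : {perm vertex G} * {perm edge G} |
   [forall e : edge G, exists c : bool, forall b : bool,
     endpoint (fg.2 e) (b (+) c) == fg.1 (endpoint e b)]].

Definition trivial_automorphism_group (G : mgraph) : Prop :=
  automorphisms G = [set (1%g, 1%g)].

(* A ribbon graph of [G] as one (arbitrarily oriented) disk per vertex and one
   band per edge: the permutation of the half-edges has as cycles the
   counterclockwise cyclic orders in which the band ends are attached around
   the disks, and the boolean of an edge tells whether its band is
   half-twisted relative to the chosen orientations of the disks at its ends.
   Every ribbon graph of [G] is obtained in this way, but several data may
   describe equivalent ribbon graphs, see [ribbon_equiv]. *)
Definition is_rotation (G : mgraph) (s : {perm half G}) : bool :=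
  [forall h : half G, porbit s h == star (endpoint h.1 h.2)].

Record ribbon (G : mgraph) := Ribbon {
  ribbon_data : {perm half G} * {ffun edge G -> bool};
  ribbon_dataP : is_rotation ribbon_data.1
}.

HB.instance Definition _ (G : mgraph) := [isSub for @ribbon_data G].
HB.instance Definition _ (G : mgraph) := [Equality of ribbon G by <:].
HB.instance Definition _ (G : mgraph) := [Choice of ribbon G by <:].
HB.instance Definition _ (G : mgraph) := [Countable of ribbon G by <:].
HB.instance Definition _ (G : mgraph) := [Finite of ribbon G by <:].

Definition rotation (G : mgraph) (R : ribbon G) : {perm half G} :=
  (ribbon_data R).1.
Definition twisted (G : mgraph) (R : ribbon G) : {ffun edge G -> bool} :=
  (ribbon_data R).2.

(* A flag [(h, s)] is one of the two corners of the band end [h], with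
   [s = true] for the one met last when running counterclockwise around the
   vertex disk. *)
Definition flag (G : mgraph) : finType := (half G * bool)%type.

(* The other corner of the same band end. *)
Definition flip (G : mgraph) (x : flag G) : flag G := (x.1, ~~ x.2).

(* The other end of the arc of the vertex disk boundary, between two
   consecutive band ends, that starts at the flag. *)
Definition corner (G : mgraph) (R : ribbon G) (x : flag G) : flag G :=
  if x.2 then (rotation R x.1, false) else ((rotation R)^-1%g x.1, true).

(* The other end of the free side of the band that starts at the flag; an
   untwisted band between two oriented disks exchanges "first" and "last". *)
Definition side (G : mgraph) (R : ribbon G) (x : flag G) : flag G :=
  ((x.1.1, ~~ x.1.2), ~~ x.2 (+) twisted R x.1.1).

(* Boundary circles alternate disk arcs and band sides, so the faces of the
   closed surface are the classes of flags under [corner] and [side] (every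
   disk carries at least one band when [G] has no isolated vertex). *)
Definition boundary_step (G : mgraph) (R : ribbon G) : rel (flag G) :=
  fun x y => (y == corner R x) || (y == side R x).

Definition boundary (G : mgraph) (R : ribbon G) (x : flag G) : {set flag G} :=
  [set y | connect (boundary_step R) x y].

Definition faces (G : mgraph) (R : ribbon G) : {set {set flag G}} :=
  [set boundary R x | x : flag G].

Definition face (G : mgraph) (R : ribbon G) : finType :=
  {F : {set flag G} | F \in faces R}.

Lemma boundary_in_faces (G : mgraph) (R : ribbon G) (x : flag G) :
  boundary R x \in faces R.
Proof. exact: imset_f. Qed.

Definition face_of (G : mgraph) (R : ribbon G) (x : flag G) : face R :=
  exist _ (boundary R x) (boundary_in_faces R x).

(* A homeomorphism of the closed surfaces carrying graph to graph permutes the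
   flags compatibly with the three involutions above, and conversely; the
   induced isomorphism of [G] is the action on pairs of flags exchanged by
   [flip]. *)
Definition ribbon_equiv (G : mgraph) : rel (ribbon G) :=
  fun R S => [exists f : {perm flag G}, forall x : flag G,
    [&& f (flip x) == flip (f x),
        f (corner R x) == corner S (f x)
      & f (side R x) == side S (f x)]].

Lemma ribbon_equivP (G : mgraph) :
  {in [set: ribbon G] & &, equivalence_rel (@ribbon_equiv G)}.
Proof.
have refl (R : ribbon G) : ribbon_equiv R R.
  by apply/existsP; exists 1%g; apply/forallP=> x; rewrite !perm1 !eqxx.
have sym (R S : ribbon G) : ribbon_equiv R S -> ribbon_equiv S R.
  case/existsP=> f /forallP fP; apply/existsP; exists f^-1%g.
  apply/forallP=> x; have /and3P[/eqP e1 /eqP e2 /eqP e3] := fP (f^-1%g x).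
  rewrite -{1}(permKV f x) -e1 permK eqxx -{1}(permKV f x) -e2 permK eqxx.
  by rewrite -{1}(permKV f x) -e3 permK eqxx.
have trans (R S T : ribbon G) :
    ribbon_equiv R S -> ribbon_equiv S T -> ribbon_equiv R T.
  case/existsP=> f /forallP fP /existsP[g /forallP gP].
  apply/existsP; exists (f * g)%g; apply/forallP=> x; rewrite !permM.
  have /and3P[/eqP-> /eqP-> /eqP->] := fP x; exact: gP.
move=> R S T _ _ _; split=> // RS; apply/idP/idP; apply: trans => //.
exact: sym.
Qed.

(* [T] contains exactly one ribbon graph of each equivalence class. *)
Definition represents_all_ribbon_graphs (G : mgraph) (T : {set ribbon G}) :
    Prop :=
  is_transversal T (equivalence_partition (@ribbon_equiv G) [set: ribbon G])
    [set: ribbon G].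

(* The ribbon graph Gamma_alpha. *)
Definition half_twist (G : mgraph) (R : ribbon G)
    (a : {ffun edge G -> bool}) : ribbon G :=
  @Ribbon G (rotation R, [ffun e => twisted R e (+) a e]) (ribbon_dataP R).

Definition num_twists (G : mgraph) (a : {ffun edge G -> bool}) : nat :=
  (\sum_(e : edge G) a e)%N.

Definition penrose (G : mgraph) (R : ribbon G) : {poly int} :=
  \sum_(a : {ffun edge G -> bool})
     (-1) ^+ num_twists a *: 'X^(#|faces (half_twist R a)|).

Definition positive_ribbon (G : mgraph) (R : ribbon G) : bool :=
  (penrose R != 0) && (0 < lead_coef (penrose R))%R.

Definition zero_ribbon (G : mgraph) (R : ribbon G) : bool := penrose R == 0.

Definition nonnegative_ribbon (G : mgraph) (R : ribbon G) : bool :=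
  positive_ribbon R || zero_ribbon R.

(* The common value of [penrose] on the nonnegative ribbon graphs of a
   connected trivalent graph (0 if there were none). *)
Definition graph_penrose (G : mgraph) : {poly int} :=
  if [pick R : ribbon G | nonnegative_ribbon R] is Some R then penrose R
  else 0.

Definition even_ribbon (G : mgraph) (Gamma R : ribbon G) : bool :=
  [exists a : {ffun edge G -> bool},
    ~~ odd (num_twists a) && ribbon_equiv (half_twist R a) Gamma].

Definition odd_ribbon (G : mgraph) (Gamma R : ribbon G) : bool :=
  ~~ even_ribbon Gamma R.

Definition face_colorings (G : mgraph) (R : ribbon G) (n : nat) :
    {set {ffun face R -> 'I_n}} :=
  [set c : {ffun face R -> 'I_n} |
    [forall h : half G, c (face_of R (h, false)) != c (face_of R (h, true))]].

Definition num_face_colorings (G : mgraph) (R : ribbon G) (n : nat) : nat :=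
  #|face_colorings R n|.

(* Among closed connected surfaces, the sphere is the one of Euler
   characteristic 2; a connected graph is planar iff it has a cellular
   embedding in the sphere, i.e. a plane ribbon graph. *)
Definition euler_characteristic (G : mgraph) (R : ribbon G) : int :=
  #|vertex G|%:Z - #|edge G|%:Z + #|faces R|%:Z.

Definition planar (G : mgraph) : Prop :=
  exists R : ribbon G, euler_characteristic R = 2.

(* Main.v *)
Require Import Defs.
From mathcomp Require Import all_boot all_order all_fingroup all_algebra.
From mathcomp Require Import ring zify.

(* Expanding each power of [n] as the number of all colorings of the faces of
   [half_twist R a], the colorings with equal colors on the two sides of some
   edge cancel in pairs, because twisting this edge preserves them.  Hence the
   Penrose polynomial at [n] is the sum over [a] of the signed numbers of proper
   face colorings.  Reversing the orientations of vertex disks identifies every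
   ribbon graph of a trivalent graph with a unique [half_twist R a], and without
   automorphisms there are no further equivalences (if a loop can be reversed,
   there is a bridge and both sides vanish).  If [R] is plane, the boundaries of
   the faces of two given colors in a proper coloring of [half_twist R a] are
   closed curves crossing once on each twisted edge between these colors, so the
   number of twisted edges is even and all signs are positive. *)

Set Implicit Arguments.
Unset Strict Implicit.
Unset Printing Implicit Defensive.

Section Proof.
Import Order.TTheory GRing.Theory Num.Theory.
Local Open Scope ring_scope.
(* [half] alone would be the [ssrnat] function. *)
Local Notation half := Defs.half.

(** * Colorings of flags *)

Definition base (G : mgraph) (h : half G) : vertex G := endpoint h.1 h.2.

Definition opposite (G : mgraph) (h : half G) : half G := (h.1, ~~ h.2).

Lemma porbit_rotation (G : mgraph) (R : ribbon G) (h : half G) :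
  porbit (rotation R) h = star (base h).
Proof. by apply/eqP; move/forallP: (ribbon_dataP R); apply. Qed.

Lemma base_rotation (G : mgraph) (R : ribbon G) (h : half G) :
  base (rotation R h) = base h.
Proof.
have := mem_porbit (rotation R) 1 h.
by rewrite expg1 porbit_rotation inE => /eqP.
Qed.

Lemma base_rotationV (G : mgraph) (R : ribbon G) (h : half G) :
  base ((rotation R)^-1%g h) = base h.
Proof. by rewrite -(base_rotation R) permKV. Qed.

Lemma side_involutive (G : mgraph) (R : ribbon G) : involutive (@side G R).
Proof.
by case=> [[e b] s]; rewrite /side /= negbK; case: s; case: (twisted R e).
Qed.

Lemma corner_involutive (G : mgraph) (R : ribbon G) : involutive (@corner G R).
Proof. by case=> [h []]; rewrite /corner /= ?permK ?permKV. Qed.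

Lemma face_of_eq (G : mgraph) (R : ribbon G) (x y : flag G) :
  (face_of R x == face_of R y) = connect (boundary_step R) x y.
Proof.
have sym : connect_sym (boundary_step R).
  apply: sym_connect_sym => a b; rewrite /boundary_step.
  by rewrite -(can2_eq (corner_involutive R) (corner_involutive R))
             -(can2_eq (side_involutive R) (side_involutive R)) !(eq_sym a).
apply/eqP/idP => [/(congr1 val) /= eF | xy].
  have: y \in boundary R y by rewrite inE connect0.
  by rewrite -eF inE.
apply: val_inj => /=; apply/setP=> z; rewrite !inE.
exact: same_connect.
Qed.

(* A coloring of the faces, seen as a function on flags. *)
Definition flag_coloring (G : mgraph) (R : ribbon G) (A : eqType)
    (c : flag G -> A) : bool :=
  [forall x, (c (corner R x) == c x) && (c (side R x) == c x)].

Definition proper_coloring (G : mgraph) (A : eqType) (c : flag G -> A) : bool :=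
  [forall h, c (h, false) != c (h, true)].

Lemma flag_coloringP (G : mgraph) (R : ribbon G) (A : eqType)
    (c : flag G -> A) :
  reflect ((forall x, c (corner R x) = c x) /\ (forall x, c (side R x) = c x))
          (flag_coloring R c).
Proof.
apply: (iffP forallP) => [H | [H1 H2] x]; last by rewrite H1 H2 !eqxx.
by split=> x; have /andP[/eqP ? /eqP ?] := H x.
Qed.

Definition lift_coloring (G : mgraph) (R : ribbon G) (n : nat)
    (c : {ffun face R -> 'I_n}) : {ffun flag G -> 'I_n} :=
  [ffun x => c (face_of R x)].

Lemma face_of_surj (G : mgraph) (R : ribbon G) (F : face R) :
  exists x, F == face_of R x.
Proof.
case: F => F FP; case/imsetP: (FP) => x _ eF.
by exists x; apply/eqP/val_inj.
Qed.

Lemma lift_coloring_inj (G : mgraph) (R : ribbon G) (n : nat) :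
  injective (@lift_coloring G R n).
Proof.
move=> c d /ffunP E; apply/ffunP=> F; have [x /eqP->] := face_of_surj F.
by have := E x; rewrite !ffunE.
Qed.

(** Invariance under [corner] and [side] makes [c] constant along boundary circles, so it descends
    to faces. The type of flags, unlike that of faces, does not depend on the twists, so one [c] can
    be tested against every [half_twist R a]. *)
Lemma lift_coloringE (G : mgraph) (R : ribbon G) (n : nat)
    (c : {ffun flag G -> 'I_n}) :
  flag_coloring R c = (c \in codom (@lift_coloring G R n)).
Proof.
apply/idP/idP => [cP | /codomP[d ->]]; last first.
  apply/flag_coloringP; split=> x; rewrite !ffunE; congr (d _); apply/eqP;
    rewrite eq_sym face_of_eq connect1 // /boundary_step eqxx ?orbT //.
have [cC cS] := flag_coloringP _ _ cP.
have cF x y : connect (boundary_step R) x y -> c x = c y.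
  case/connectP=> p; elim: p x => [|z p IH] x /=; first by move=> _ ->.
  by case/andP=> /orP[] /eqP -> zp yE; rewrite -(IH _ zp yE).
apply/codomP.
exists [ffun F => c (xchoose (face_of_surj F))].
apply/ffunP=> x; rewrite !ffunE; apply: cF; rewrite -face_of_eq.
exact: (xchooseP (face_of_surj (face_of R x))).
Qed.

Lemma card_flag_colorings (G : mgraph) (R : ribbon G) (n : nat) :
  #|[pred c : {ffun flag G -> 'I_n} | flag_coloring R c]| = (n ^ #|faces R|)%N.
Proof.
rewrite (eq_card (B := mem (codom (@lift_coloring G R n)))); last first.
  by move=> c; rewrite inE lift_coloringE.
rewrite (card_codom (@lift_coloring_inj G R n)) card_ffun card_ord.
by rewrite card_sig; congr (n ^ _)%N; apply: eq_card => F; rewrite inE.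
Qed.

Lemma num_face_coloringsE (G : mgraph) (R : ribbon G) (n : nat) :
  num_face_colorings R n =
  #|[pred c : {ffun flag G -> 'I_n} | flag_coloring R c && proper_coloring c]|.
Proof.
rewrite /num_face_colorings -(card_image (@lift_coloring_inj G R n)).
have lift_proper d : proper_coloring (lift_coloring d) = (d \in face_colorings R n).
  by rewrite inE; apply: eq_forallb => h; rewrite !ffunE.
apply: eq_card => c; rewrite inE /= lift_coloringE.
apply/imageP/andP => [[d dP ->] | [/codomP[d ->]]].
  by rewrite codom_f lift_proper.
by rewrite lift_proper; exists d.
Qed.

(** * Half-twists and the coloring expansion *)

Definition add_twist (G : mgraph) (b a : {ffun edge G -> bool}) :
  {ffun edge G -> bool} := [ffun e => a e (+) b e].

Lemma add_twistK (G : mgraph) (b : {ffun edge G -> bool}) :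
  involutive (add_twist b).
Proof. by move=> a; apply/ffunP=> e; rewrite !ffunE addbK. Qed.

Lemma sign_num_twists (G : mgraph) (a : {ffun edge G -> bool}) :
  (-1) ^+ num_twists a = \prod_(e : edge G) (-1) ^+ a e :> int.
Proof. by rewrite expr_sum. Qed.

Lemma sign_num_twists_add (G : mgraph) (a b : {ffun edge G -> bool}) :
  (-1) ^+ num_twists (add_twist b a) =
  (-1) ^+ num_twists a * (-1) ^+ num_twists b :> int.
Proof.
rewrite !sign_num_twists -big_split /=; apply: eq_bigr => e _.
by rewrite ffunE signr_addb.
Qed.

Definition delta_twist (G : mgraph) (e : edge G) : {ffun edge G -> bool} :=
  [ffun e' => e' == e].

Lemma num_twists_delta (G : mgraph) (e : edge G) :
  num_twists (delta_twist e) = 1%N.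
Proof.
rewrite /num_twists (bigD1 e) //= ffunE eqxx big1 // => e' /negbTE ne.
by rewrite ffunE ne.
Qed.

(* Both sides of the band carry the color of [h], so that a further half-twist
   does not matter. *)
Lemma flag_coloring_toggle (G : mgraph) (R : ribbon G) (A : eqType)
    (c : flag G -> A) (h : half G) (a : {ffun edge G -> bool}) :
  c (h, false) = c (h, true) ->
  flag_coloring (half_twist R a) c ->
  flag_coloring (half_twist R (add_twist (delta_twist h.1) a)) c.
Proof.
move=> ch /flag_coloringP[cC cS]; apply/flag_coloringP; split=> [x|].
  exact: (cC x).
have hF : forall b s, c ((h.1, b), s) = c (h, false).
  have h1 s : c (h, s) = c (h, false) by case: s.
  have h2 s : c (opposite h, s) = c (h, false).
    have := cS (opposite h, s).
    rewrite /side /= negbK => <-; rewrite -surjective_pairing; exact: h1.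
  move=> b s; have [->|] := eqVneq b h.2.
    by rewrite -surjective_pairing.
  by move=> nb; rewrite -(h2 s) /opposite; congr (c (_, _, _)); case: b h.2 nb => [] [].
case=> [[e b] s]; have := cS (e, b, s); rewrite /side /= !ffunE.
have [->|ne] := eqVneq e h.1; first by rewrite !hF.
by rewrite addbF.
Qed.

Lemma penrose_coloring (G : mgraph) (R : ribbon G) (n : nat) :
  (penrose R).[n%:R] =
  \sum_(a : {ffun edge G -> bool})
     (-1) ^+ num_twists a * (num_face_colorings (half_twist R a) n)%:R.
Proof.
rewrite /penrose horner_sum.
under eq_bigr => a _.
  rewrite hornerZ hornerXn -natrX -card_flag_colorings.
  rewrite -sum1_card natr_sum mulr_sumr big_mkcond /=.
  over.
under [RHS]eq_bigr => a _.
  rewrite num_face_coloringsE.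
  rewrite -sum1_card natr_sum mulr_sumr big_mkcond /=.
  over.
(* From here the coloring [c] is fixed and the twists [a] vary. *)
rewrite exchange_big [RHS]exchange_big /=; apply: eq_bigr => c _.
have [pc|npc] := boolP (proper_coloring c).
  by apply: eq_bigr => a _; rewrite !inE pc andbT.
rewrite [RHS]big1; last by move=> a _; rewrite inE (negbTE npc) andbF.
move: npc; rewrite negb_forall => /existsP[h]; rewrite negbK => /eqP ch.
(* Toggling the twist of the monochromatic edge [h.1] reverses the sign and keeps [c] compatible. *)
set S := LHS; suff : S = - S by move/eqP; rewrite eq_sym eqNr => /eqP.
have inj := can_inj (add_twistK (delta_twist h.1)).
rewrite {1}/S (reindex_inj inj) -sumrN; apply: eq_bigr => a _.
rewrite !inE sign_num_twists_add num_twists_delta expr1 mulrN1 mulNr.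
have -> : flag_coloring (half_twist R (add_twist (delta_twist h.1) a)) c =
          flag_coloring (half_twist R a) c.
  apply/idP/idP; last exact: flag_coloring_toggle.
  by move/(flag_coloring_toggle ch); rewrite add_twistK.
by case: ifP; rewrite ?oppr0.
Qed.

(** * Equivalence of ribbon graphs *)

Lemma ribbon_equiv_refl (G : mgraph) : reflexive (@ribbon_equiv G).
Proof.
by move=> R; have [] := @ribbon_equivP G R R R (in_setT _) (in_setT _) (in_setT _).
Qed.

Lemma ribbon_equiv_left (G : mgraph) (R S T : ribbon G) :
  ribbon_equiv R S -> ribbon_equiv R T = ribbon_equiv S T.
Proof.
by have [_] := @ribbon_equivP G R S T (in_setT _) (in_setT _) (in_setT _).
Qed.

Lemma ribbon_equiv_sym (G : mgraph) : symmetric (@ribbon_equiv G).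
Proof.
suff H (R S : ribbon G) : ribbon_equiv R S -> ribbon_equiv S R.
  by move=> R S; apply/idP/idP; apply: H.
by move/ribbon_equiv_left=> <-; apply: ribbon_equiv_refl.
Qed.

Lemma proper_coloringP (G : mgraph) (A : eqType) (c : flag G -> A) :
  reflect (forall x, c (flip x) != c x) (proper_coloring c).
Proof.
apply: (iffP forallP) => [H [h []] | H h]; rewrite /flip /=.
- exact: H.
- by rewrite eq_sym; exact: H.
- exact: (H (h, true)).
Qed.

Lemma num_face_colorings_equiv (G : mgraph) (R S : ribbon G) (n : nat) :
  ribbon_equiv R S -> num_face_colorings R n = num_face_colorings S n.
Proof.
suff le (R' S' : ribbon G) : ribbon_equiv R' S' ->
    (num_face_colorings S' n <= num_face_colorings R' n)%N.
  move=> RS; apply/eqP; rewrite eqn_leq !le // ribbon_equiv_sym //.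
case/existsP=> f /forallP fP; rewrite !num_face_coloringsE.
pose g (c : {ffun flag G -> 'I_n}) := [ffun x => c (f x)].
have g_inj : injective g.
  move=> c d /ffunP E; apply/ffunP=> x; have := E (f^-1%g x).
  by rewrite !ffunE permKV.
rewrite -(card_image g_inj); apply: subset_leq_card; apply/subsetP=> d.
case/imageP=> c; rewrite inE => /andP[/flag_coloringP[cC cS] /proper_coloringP cP] ->.
rewrite inE; apply/andP; split.
  by apply/flag_coloringP; split=> x; rewrite !ffunE;
    have /and3P[_ /eqP e2 /eqP e3] := fP x; rewrite ?e2 ?e3.
by apply/proper_coloringP=> x; rewrite !ffunE; have /and3P[/eqP-> _ _] := fP x.
Qed.

(* Reversing the chosen orientation of the disks at the vertices in [u] turns
   the data [R] into the data [S]. *)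
Definition vertex_flip (G : mgraph) (u : vertex G -> bool)
    (R S : ribbon G) : Prop :=
  (forall h, rotation S h =
     if u (base h) then (rotation R)^-1%g h else rotation R h) /\
  (forall e, twisted S e =
     twisted R e (+) (u (endpoint e false) (+) u (endpoint e true))).

Lemma twisted_half_twist (G : mgraph) (R : ribbon G) a e :
  twisted (half_twist R a) e = twisted R e (+) a e.
Proof. by rewrite /half_twist /twisted /= ffunE. Qed.

Lemma vertex_flip_rotationV (G : mgraph) (u : vertex G -> bool)
    (R S : ribbon G) (h : half G) : vertex_flip u R S ->
  (rotation S)^-1%g h = if u (base h) then rotation R h else (rotation R)^-1%g h.
Proof.
case=> H _; apply: (can_inj (permK (rotation S))); rewrite permKV H.
by case uh: (u (base h)); rewrite ?base_rotation ?base_rotationV uh ?permK ?permKV.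
Qed.

Lemma vertex_flip_equiv (G : mgraph) (u : vertex G -> bool) (R S : ribbon G) :
  vertex_flip u R S -> ribbon_equiv R S.
Proof.
move=> RS; have [rS tS] := RS.
(* Reversing the orientation of a disk exchanges the two corners of each of its band ends. *)
pose f (x : flag G) : flag G := (x.1, x.2 (+) u (base x.1)).
have fK : involutive f by case=> h s; rewrite /f /= addbK.
apply/existsP; exists (perm (can_inj fK)); apply/forallP=> [[[e b] s]].
rewrite !permE; apply/and3P; split; apply/eqP.
- by rewrite /f /flip /= addNb.
- rewrite /f /corner /=; case: s => /=.
    rewrite base_rotation; case E: (u _) => /=.
      by rewrite (vertex_flip_rotationV _ RS) E.
    by rewrite rS E.
  rewrite base_rotationV; case E: (u _) => /=.
    by rewrite rS E.
  by rewrite (vertex_flip_rotationV _ RS) E.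
- rewrite /f /side /base /= tS; congr (_, _).
  case: b; case: s; do 2!case: (u _); by case: (twisted R e).
Qed.

Lemma vertex_flip_half_twist (G : mgraph) (u : vertex G -> bool)
    (R S : ribbon G) (a b : {ffun edge G -> bool}) :
  vertex_flip u (half_twist R a) S ->
  vertex_flip u (half_twist R (add_twist b a)) (half_twist S b).
Proof.
case=> H1 H2; split=> [h|e]; first exact: H1.
rewrite !twisted_half_twist H2 twisted_half_twist ffunE.
by rewrite -!addbA; congr (_ (+) _); congr (_ (+) _); rewrite !addbA addbC !addbA.
Qed.

(** * Rotations at trivalent vertices *)

Section Trivalent.
Variables (G : mgraph) (G3 : trivalent G).

Lemma rotation3 (R : ribbon G) (h : half G) :
  [/\ rotation R h != h, rotation R (rotation R h) = (rotation R)^-1%g h,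
      rotation R h != (rotation R)^-1%g h & (rotation R)^-1%g h != h].
Proof.
have c3 : #|porbit (rotation R) h| = 3%N by rewrite porbit_rotation G3.
have := uniq_traject_porbit (rotation R) h.
have := iter_porbit (rotation R) h; rewrite c3 /= => e3.
rewrite !inE negb_or andbT => /andP[/andP[n1 n2] n3].
have e2 : rotation R (rotation R h) = (rotation R)^-1%g h.
  by apply: (can_inj (permK (rotation R))); rewrite permKV.
by split; rewrite -?e2 // eq_sym.
Qed.

Lemma starE (R : ribbon G) (h k : half G) : base k = base h ->
  [|| k == h, k == rotation R h | k == (rotation R)^-1%g h].
Proof.
move=> bk; have : k \in porbit (rotation R) h.
  by rewrite porbit_rotation inE; apply/eqP.
have [n1 e2 n2 n3] := rotation3 R h.
suff -> : porbit (rotation R) h =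
    h |: [set rotation R h; (rotation R)^-1%g h] by rewrite !inE.
apply/eqP; rewrite eq_sym eqEcard porbit_rotation G3.
rewrite cardsU1 cards2 !inE (eq_sym h) (negbTE n1).
rewrite (eq_sym h) (negbTE n3) n2 andbT.
apply/subsetP=> x; rewrite !inE => /or3P[] /eqP ->;
  apply/eqP; first by [].
- exact: base_rotation.
- exact: base_rotationV.
Qed.

(** Three half-edges have only two cyclic orders, inverse to each other. The value at [rotation R h]
    is included so that the alternative propagates around the star. *)
Lemma rotation_cases (R S : ribbon G) (h : half G) :
  (rotation S h = rotation R h /\
   rotation S (rotation R h) = rotation R (rotation R h)) \/
  (rotation S h = (rotation R)^-1%g h /\ rotation S (rotation R h) = h).
Proof.
have [n1 e2 n2 n3] := rotation3 R h.
have [m1 f2 m2 m3] := rotation3 S h.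
have := starE R (base_rotation S h); rewrite (negbTE m1) /= => /orP[]/eqP E.
  left; split=> //; rewrite -E f2 E e2.
  have := starE R (base_rotationV S h); rewrite (negbTE m3) -E eq_sym.
  by rewrite (negbTE m2) => /eqP.
right; split=> //; have := starE R (base_rotationV S h).
rewrite (negbTE m3) -E [_ == rotation S h]eq_sym (negbTE m2) orbF /=.
by move/eqP=> <-; rewrite permKV.
Qed.

Lemma exists_vertex_flip (R S : ribbon G) :
  exists b u, vertex_flip u (half_twist R b) S.
Proof.
pose v (w : vertex G) :=
  [exists h : half G, (base h == w) && (rotation S h != rotation R h)].
(* By [rotation_cases], rotations that differ at one half-edge differ on its whole star. *)
have vP h : v (base h) = (rotation S h != rotation R h).
  apply/idP/idP => [/existsP[k /andP[/eqP bk nk]]|nh]; last first.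
    by apply/existsP; exists h; rewrite eqxx.
  case: (rotation_cases R S h) => [[E1 E2]|[E1 E2]]; last first.
    by rewrite E1 eq_sym; have [] := rotation3 R h.
  have [n1 e2 n2 n3] := rotation3 R h.
  case/negP: nk; have := starE R bk => /or3P[] /eqP ->; rewrite ?E1 ?E2 //.
  case: (rotation_cases R S (rotation R h)) => [[_]|[F _]].
    by rewrite e2 => ->.
  by move: n3; rewrite -e2 -E2 F permK eqxx.
(* These twists solve the second clause of [vertex_flip]. *)
exists [ffun e => twisted S e (+)
  (twisted R e (+) (v (endpoint e false) (+) v (endpoint e true)))], v.
split=> [h|e].
  rewrite vP /=; case: (rotation_cases R S h) => [[E _]|[E _]].
    by rewrite E eqxx.
  by rewrite E eq_sym; have [_ _ -> _] := rotation3 R h.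
rewrite twisted_half_twist ffunE.
by case: (twisted R e); case: (twisted S e); case: (v _); case: (v _).
Qed.

(** A 3-cycle differs from its inverse, so equal rotations leave no vertex to flip. *)
Lemma vertex_flip_twist_inj (R : ribbon G) (a b : {ffun edge G -> bool})
    (u : vertex G -> bool) :
  vertex_flip u (half_twist R a) (half_twist R b) -> a = b.
Proof.
case=> H1 H2.
have u0 h : u (base h) = false.
  have := H1 h; rewrite /rotation /=; case: (u _) => // E.
  by have [_ _ /eqP] := rotation3 R h.
apply/ffunP=> e; have := H2 e; rewrite !twisted_half_twist.
rewrite (u0 (e, false)) (u0 (e, true)) !addbF.
by move/addbI.
Qed.

End Trivalent.

(** * Trivial automorphism group *)

Definition loopless (G : mgraph) : bool :=
  [forall e : edge G, endpoint e false != endpoint e true].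

(* The vertex carrying a loop has a single other edge, a bridge, and the face
   on one side of this bridge runs around the loop to its other side. *)
Lemma loop_no_coloring (G : mgraph) (R : ribbon G) (n : nat) :
  trivalent G -> ~~ loopless G -> num_face_colorings R n = 0%N.
Proof.
move=> G3; rewrite negb_forall => /existsP[e]; rewrite negbK => /eqP le.
rewrite num_face_coloringsE; apply: eq_card0 => c; rewrite inE.
apply/negbTE/negP=> /andP[/flag_coloringP[cC cS] /proper_coloringP cP].
have [b bE] : exists b, (rotation R (e, b) == (e, ~~ b)).
  have /(starE G3 R) : base (e, true) = base (e, false) by rewrite /base /= le.
  case/or3P=> [|/eqP rE|/eqP rE]; first by rewrite /eq_op /= andbF.
    by exists false; rewrite -rE.
  by exists true; rewrite rE permKV.
(* The third half-edge at the vertex of the loop, an end of the bridge. *)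
pose k := (rotation R)^-1%g (e, b).
have [_ ssE _ _] := rotation3 G3 R (e, b); move/eqP: bE => bE.
have r1 : rotation R (e, ~~ b) = k by rewrite -bE ssE.
have r2 : rotation R k = (e, b) by rewrite permKV.
have C1 : c (k, true) = c ((e, b), false) by rewrite -(cC (k, true)) /corner /= r2.
have C2 : c ((e, b), true) = c ((e, ~~ b), false).
  by rewrite -(cC ((e, b), true)) /corner /= bE.
have C3 : c ((e, ~~ b), true) = c (k, false).
  by rewrite -(cC ((e, ~~ b), true)) /corner /= r1.
(* The boundary circle leaving one side of [k] returns on the other, after running along the loop
   once if it is untwisted and twice if it is twisted. *)
have /negP[] := cP (k, false); rewrite /flip /= C1 -C3.
have := cS ((e, b), false); have := cS ((e, b), true); rewrite /side /=.
case: (twisted R e) => /= E1 E2; last by rewrite E2.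
by rewrite E1 C2 E2.
Qed.

Section Rigid.
Variables (G : mgraph) (G3 : trivalent G).

Lemma base_surj (v : vertex G) : exists h : half G, base h == v.
Proof.
have : (0 < #|star v|)%N by rewrite G3.
by case/card_gt0P=> h; rewrite inE; exists h.
Qed.

(** Commuting with [flip], [side] and [corner] makes [f] act on half-edges, edges and vertices,
    through [p], [g] and [w]; the last two form an automorphism, which must be trivial. The two ends
    of a loop might still be exchanged. *)
Lemma equiv_fixes_edges (R S : ribbon G) (f : {perm flag G}) :
  trivial_automorphism_group G ->
  (forall x, [&& f (flip x) == flip (f x), f (corner R x) == corner S (f x)
               & f (side R x) == side S (f x)]) ->
  forall x, (f x).1.1 = x.1.1 /\ base (f x).1 = base x.1.
Proof.
move=> Gtriv fP.
have fF x : f (flip x) = flip (f x) by have /and3P[/eqP] := fP x.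
have fC x : f (corner R x) = corner S (f x) by have /and3P[_ /eqP] := fP x.
have fS x : f (side R x) = side S (f x) by have /and3P[_ _ /eqP] := fP x.
pose p (h : half G) : half G := (f (h, false)).1.
have pE x : (f x).1 = p x.1.
  case: x => h []; rewrite /p //=.
  by have -> : (h, true) = flip (h, false) by []; rewrite fF.
have p_inj : injective p.
  move=> h k hk; have [E|nE] := eqVneq (f (h, false)).2 (f (k, false)).2.
    have/perm_inj[//] : f (h, false) = f (k, false).
    by rewrite (surjective_pairing (f (h, false))) E -/(p h) hk /p
               -surjective_pairing.
  have/perm_inj[//] : f (h, false) = f (flip (k, false)).
  rewrite fF (surjective_pairing (f (h, false))) -/(p h) hk /p /flip.
  by congr (_, _); case: (f (h, false)).2 nE; case: (f (k, false)).2.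
have pO h : p (opposite h) = opposite (p h).
  have := congr1 fst (fS (h, false)); rewrite pE /side /= => ->.
  by rewrite pE.
have pR h : base (p (rotation R h)) = base (p h).
  have := congr1 fst (fC (h, true)); rewrite pE /corner /= => ->.
  by case: ifP => _; rewrite ?base_rotation ?base_rotationV pE.
have pB h k : base h = base k -> base (p h) = base (p k).
  move=> bhk; have : h \in porbit (rotation R) k.
    by rewrite porbit_rotation inE; apply/eqP.
  case/porbitP=> i ->; elim: i => [|i IH]; first by rewrite expg0 perm1.
  by rewrite expgSr permM pR.
pose g e := (p (e, false)).1.
have gE h : (p h).1 = g h.1.
  case: h => e []; rewrite /g //=.
  by have -> : (e, true) = opposite (e, false) by []; rewrite pO.
have g_inj : injective g.
  move=> e d ed; have [E|nE] := eqVneq (p (e, false)).2 (p (d, false)).2.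
    have/p_inj[//] : p (e, false) = p (d, false).
    by rewrite (surjective_pairing (p (e, false))) E -/(g e) ed /g
               -surjective_pairing.
  have/p_inj[//] : p (e, false) = p (opposite (d, false)).
  rewrite pO (surjective_pairing (p (e, false))) -/(g e) ed /g /opposite.
  by congr (_, _); case: (p (e, false)).2 nE; case: (p (d, false)).2.
pose w v := base (p (xchoose (base_surj v))).
have wE h : w (base h) = base (p h).
  by apply: pB; apply/eqP; exact: (xchooseP (base_surj (base h))).
have w_inj : injective w.
  have full : #|codom w| == #|vertex G|.
    rewrite -[X in _ == X]cardsT; apply/eqP/eq_card=> v; rewrite !inE.
    have [h /eqP <-] := base_surj v.
    have -> : base h = w (base (invF p_inj h)) by rewrite wE f_invF.
    exact: codom_f.
  by move=> u v; move/image_injP: full; apply.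
have : (perm w_inj, perm g_inj) \in automorphisms G.
  rewrite inE; apply/forallP=> e; apply/existsP; exists (p (e, false)).2.
  apply/forallP=> b /=; rewrite !permE -/(base (e, b)) wE.
  rewrite /base; apply/eqP; rewrite gE /=.
  congr (endpoint _ _); case: b => //=.
  by have -> : (e, true) = opposite (e, false) by []; rewrite pO.
rewrite Gtriv inE => /eqP[/permP w1 /permP g1] x.
rewrite pE gE -wE; have := w1 (base x.1); have := g1 x.1.1.
by rewrite !permE => -> ->.
Qed.

(** Without loops the ends of an edge lie at different vertices, so [f] fixes half-edges and can
    only exchange the two corners of a band end. Following [corner] around a disk, it does so at all
    band ends of a vertex or at none. *)
Lemma equiv_vertex_flip (R S : ribbon G) :
  trivial_automorphism_group G -> loopless G -> ribbon_equiv R S ->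
  exists u, vertex_flip u R S.
Proof.
move=> Gtriv /forallP noloop /existsP[f /forallP fP].
have fix1 := equiv_fixes_edges Gtriv fP.
have f1 x : (f x).1 = x.1.
  have [E1 E2] := fix1 x; apply: (etrans (surjective_pairing _)).
  rewrite (surjective_pairing x.1) E1; congr (_, _).
  move: E2; rewrite /base E1; have := noloop x.1.1.
  by case: (f x).1.2; case: x.1.2 => // /eqP n E; case: n.
have fF x : f (flip x) = flip (f x) by have /and3P[/eqP] := fP x.
have fC x : f (corner R x) = corner S (f x) by have /and3P[_ /eqP] := fP x.
have fS x : f (side R x) = side S (f x) by have /and3P[_ _ /eqP] := fP x.
pose t h := (f (h, false)).2.
have fE h b : f (h, b) = (h, b (+) t h).
  have f0 : f (h, false) = (h, t h).
    by rewrite (surjective_pairing (f _)) f1.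
  case: b => //=; have -> : (h, true) = flip (h, false) by [].
  by rewrite fF f0.
have tR h : t (rotation R h) = t h /\
    rotation R h = if t h then (rotation S)^-1%g h else rotation S h.
  have := fC (h, true); rewrite /corner /= !fE /=.
  by case: (t h) => /= -[-> ->].
have tB h k : base h = base k -> t h = t k.
  move=> bhk; have : h \in porbit (rotation R) k.
    by rewrite porbit_rotation inE; apply/eqP.
  case/porbitP=> i ->; elim: i => [|i IH]; first by rewrite expg0 perm1.
  by rewrite expgSr permM (tR _).1.
pose u v := t (xchoose (base_surj v)).
have uE h : u (base h) = t h.
  by apply: tB; apply/eqP; exact: (xchooseP (base_surj (base h))).
exists u; split=> [h|e].
  rewrite uE; case E: (t h); last by have [_ ->] := tR h; rewrite E.
  have E' : t ((rotation R)^-1%g h) = true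
    by rewrite -E; apply: tB; rewrite base_rotationV.
  by have [_] := tR ((rotation R)^-1%g h); rewrite E' permKV => {1}->; rewrite permKV.
have := congr1 snd (fS ((e, false), false)).
rewrite /side !fE /= -(uE (e, true)) -(uE (e, false)) /base /=.
by case: (twisted R e); case: (twisted S e); case: (u _); case: (u _).
Qed.

Variable (Gamma : ribbon G).

(** Makes the twist vectors [a] canonical names for the equivalence classes. *)
Lemma twist_class (R : ribbon G) :
  trivial_automorphism_group G -> loopless G ->
  exists a, forall b, ribbon_equiv (half_twist Gamma b) R = (b == a).
Proof.
move=> Gtriv noloop; have [a [u auR]] := exists_vertex_flip G3 Gamma R.
exists a => b; apply/idP/eqP => [bR | ->]; last exact: vertex_flip_equiv auR.
have : ribbon_equiv (half_twist Gamma b) (half_twist Gamma a).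
  by rewrite (ribbon_equiv_left _ bR) ribbon_equiv_sym (vertex_flip_equiv auR).
by case/(equiv_vertex_flip Gtriv noloop) => w /(vertex_flip_twist_inj G3).
Qed.

(** Twisting [R] by [b] amounts to twisting [Gamma] by the sum of [a] and [b], which gives back
    [Gamma] only for [b = a]. *)
Lemma even_ribbon_twist (R : ribbon G) (a : {ffun edge G -> bool}) :
  trivial_automorphism_group G -> loopless G ->
  ribbon_equiv (half_twist Gamma a) R ->
  even_ribbon Gamma R = ~~ odd (num_twists a).
Proof.
move=> Gtriv noloop aR.
have [u /vertex_flip_half_twist flipR] := equiv_vertex_flip Gtriv noloop aR.
have addaa : half_twist Gamma (add_twist a a) = Gamma.
  apply: val_inj; rewrite /= [RHS]surjective_pairing; congr (_, _).
  by apply/ffunP=> e; rewrite !ffunE addbb addbF.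
apply/existsP/idP => [[b /andP[evb bG]] | eva].
  have [c Hc] := twist_class Gamma Gtriv noloop.
  have := Hc (add_twist a a); rewrite addaa ribbon_equiv_refl => /esym/eqP ca.
  have := Hc (add_twist b a).
  rewrite (ribbon_equiv_left _ (vertex_flip_equiv (flipR b))) bG -ca.
  move=> /esym/eqP /ffunP E; have -> // : a = b.
  by apply/ffunP=> e; have := E e; rewrite !ffunE => /addbI.
exists a; rewrite eva /= ribbon_equiv_sym -{1}addaa.
exact: vertex_flip_equiv (flipR a).
Qed.

Lemma sum_representatives (T : {set ribbon G}) (V : nmodType)
    (F : ribbon G -> V) :
  trivial_automorphism_group G -> loopless G ->
  represents_all_ribbon_graphs T ->
  (forall R S, ribbon_equiv R S -> F R = F S) ->
  \sum_(R in T) F R = \sum_(a : {ffun edge G -> bool}) F (half_twist Gamma a).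
Proof.
move=> Gtriv noloop Trep Finv.
(* The pairs [(R, a)] with [half_twist Gamma a] equivalent to [R] are summed in two ways: each [R]
   has one [a], and each [a] has one [R] in [T]. *)
transitivity (\sum_(R in T) \sum_(a | ribbon_equiv (half_twist Gamma a) R) F R).
  apply: eq_bigr => R _; have [a aP] := twist_class R Gtriv noloop.
  by rewrite (eq_bigl _ _ aP) big_pred1_eq.
rewrite (exchange_big_dep predT) //=; apply: eq_bigr => a _.
have [R RT RE] : exists2 R, R \in T & forall S, S \in T ->
    ribbon_equiv (half_twist Gamma a) S = (S == R).
  case/and3P: Trep => _ _ /forall_inP TB.
  have /TB/cards1P[R TR] := imset_f
    (fun S => [set S' in [set: ribbon G] | ribbon_equiv S S'])
    (in_setT (half_twist Gamma a)).
  have RE S : (S \in T) && ribbon_equiv (half_twist Gamma a) S = (S == R).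
    by have := congr1 (fun A : {set _} => S \in A) TR; rewrite !inE.
  have /andP[RT _] : (R \in T) && ribbon_equiv (half_twist Gamma a) R.
    by rewrite RE.
  by exists R => // S ST; rewrite -RE ST.
rewrite (bigD1 R) /=; last by rewrite RT RE // eqxx.
rewrite big1 ?addr0; last first.
  by move=> S /andP[/andP[ST]]; rewrite RE // => ->.
by apply: Finv; rewrite ribbon_equiv_sym RE.
Qed.

End Rigid.

(** * Cycles modulo 2 *)

Lemma two_F2 : 2 = 0 :> 'F_2.
Proof. by apply: val_inj. Qed.

Lemma addrr_F2 (x : 'F_2) : x + x = 0.
Proof. by rewrite -mulr2n -mulr_natl two_F2 mul0r. Qed.

(** Modulo 2 this is the difference across the band; for the indicator of a set of faces it marks
    the edges of their boundary. *)
Definition jump (G : mgraph) (f : flag G -> 'F_2) (h : half G) : 'F_2 :=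
  f (h, false) + f (h, true).

(** Each disk arc joins [(h, true)] to [(rotation R h, false)] at the same vertex, and [f] agrees
    there, so terms cancel in pairs. With a single vertex selected, this says that boundaries are
    cycles. *)
Lemma sum_jump (G : mgraph) (R : ribbon G) (f : flag G -> 'F_2)
    (P : pred (vertex G)) :
  (forall x, f (corner R x) = f x) ->
  \sum_(h : half G | P (base h)) jump f h = 0.
Proof.
move=> fC; rewrite big_split /=.
rewrite [X in X + _](reindex_inj (@perm_inj _ (rotation R))) /=.
rewrite (eq_bigl (fun h => P (base h))); last by move=> h; rewrite base_rotation.
rewrite -big_split big1 //= => h _.
by rewrite -(fC (h, true)) /corner /= addrr_F2.
Qed.

(** Band sides carry the two values to the other end, exchanged or not, and their sum ignores the
    order. *)
Lemma jump_edge (G : mgraph) (R : ribbon G) (f : flag G -> 'F_2) (h : half G) :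
  (forall x, f (side R x) = f x) -> jump f h = jump f (h.1, false).
Proof.
move=> fS; case: h => e [] //=; rewrite /jump.
rewrite -(fS (e, true, false)) -(fS (e, true, true)) /side /=.
by case: (twisted R e) => /=; rewrite // addrC.
Qed.

Lemma connected_const (G : mgraph) (A : Type) (y : vertex G -> A) :
  connected G -> (forall h : half G, y (base h) = y (base (opposite h))) ->
  forall u v, y u = y v.
Proof.
case=> _ Gc yE u v; case/connectP: (Gc u v) => p.
elim: p u => [|w p IH] u /=; first by move=> _ ->.
case/andP=> /existsP[h /andP[/eqP hu /eqP hw]] wp vE.
by rewrite -(IH w wp vE) -hu -hw; exact: yE.
Qed.

Lemma flag_const (G : mgraph) (R : ribbon G) (f : flag G -> 'F_2) :
  connected G -> flag_coloring R f -> (forall e, jump f (e, false) = 0) ->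
  forall x y, f x = f y.
Proof.
move=> Gc /flag_coloringP[fC fS] f0.
have fF h s : f (h, s) = f (h, false).
  have := f0 h.1; rewrite -(jump_edge h fS) => /eqP.
  rewrite /jump addr_eq0 => /eqP fE; case: s => //; rewrite fE.
  by apply/eqP; rewrite -addr_eq0 addrr_F2.
have fB h k s t : base h = base k -> f (h, s) = f (k, t).
  move=> hk; rewrite fF [RHS]fF; have : h \in porbit (rotation R) k.
    by rewrite porbit_rotation inE; apply/eqP.
  case/porbitP=> i ->; elim: i => [|i IH]; first by rewrite expg0 perm1.
  by rewrite expgSr permM -IH -[RHS](fF _ true) -[RHS]fC.
(* The default 0 is taken only at vertices without half-edges, which carry no flags. *)
pose y v := if [pick h : half G | base h == v] is Some h then f (h, false) else 0.
have yE h : y (base h) = f (h, false).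
  rewrite /y; case: pickP => [k /eqP|/(_ h)]; last by rewrite eqxx.
  exact: fB.
move=> [h s] [k t]; rewrite fF [RHS]fF -!yE; apply: connected_const => // l.
by rewrite !yE -fS /side /= fF.
Qed.

(** Both ends are summed, so the column of a loop is zero modulo 2. *)
Definition incidence (G : mgraph) : 'M['F_2]_(#|vertex G|, #|edge G|) :=
  \matrix_(i, j) \sum_(b : bool) (endpoint (enum_val j) b == enum_val i)%:R.

Definition face_flags (G : mgraph) (F : {set flag G}) (x : flag G) : 'F_2 :=
  (x \in F)%:R.

(** The cellular boundary map from faces to edges modulo 2; an edge with the same face on both sides
    contributes 0. *)
Definition face_boundaries (G : mgraph) (R : ribbon G) :
    'M['F_2]_(#|faces R|, #|edge G|) :=
  \matrix_(i, j) jump (face_flags (enum_val i)) (enum_val j, false).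

(** The hypothesis confines the left kernel to the multiples of the all-ones vector. *)
Lemma rank_le1 (n : nat) (m : nat) (A : 'M['F_2]_(n, m)) :
  (forall x : 'rV_n, x *m A = 0 -> forall i j, x 0 i = x 0 j) ->
  (n <= \rank A + 1)%N.
Proof.
move=> H; suff: (\rank (kermx A) <= 1)%N by rewrite mxrank_ker; lia.
apply: leq_trans (rank_leq_row (const_mx 1 : 'rV['F_2]_n)).
apply: mxrankS; apply/rV_subP=> x; rewrite sub_kermx => /eqP /H xc.
(* With no rows there is no coordinate [x 0 0] to scale by. *)
case: n A H x xc => [|n] A H x xc; first by rewrite thinmx0 sub0mx.
have -> : x = x 0 0 *: const_mx 1.
  by apply/rowP=> i; rewrite !mxE mulr1; exact: xc.
exact: scalemx_sub.
Qed.

Lemma rank_incidence (G : mgraph) :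
  connected G -> (#|vertex G| <= \rank (incidence G) + 1)%N.
Proof.
move=> Gc; apply: rank_le1 => x x0 i j.
pose y v := x 0 (enum_rank v).
suff yc : forall u v, y u = y v.
  by have := yc (enum_val i) (enum_val j); rewrite /y !enum_valK.
apply: connected_const => // h.
suff : y (base (h.1, false)) + y (base (h.1, true)) = 0.
  have sym a b : a + b = 0 -> a = b :> 'F_2.
    by move/eqP; rewrite addr_eq0 => /eqP ->; apply/eqP; rewrite eq_sym -addr_eq0 addrr_F2.
  by case: h => e []; rewrite /opposite /= => /sym.
have := congr1 (fun A : 'rV_ _ => A 0 (enum_rank h.1)) x0; rewrite !mxE => <-.
under eq_bigr => k _ do rewrite mxE enum_rankK big_bool mulrDr.
have pick_end b : \sum_(k < #|vertex G|) x 0 k * (endpoint h.1 b == enum_val k)%:R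
    = y (base (h.1, b)).
  rewrite (bigD1 (enum_rank (endpoint h.1 b))) //= enum_rankK eqxx mulr1.
  rewrite big1 ?addr0 // => k nk; rewrite (_ : _ == _ = false) ?mulr0 //.
  by apply: contraNF nk => /eqP ->; rewrite enum_valK.
by rewrite big_split /= !pick_end addrC.
Qed.

Lemma face_flags_coloring (G : mgraph) (R : ribbon G) (F : {set flag G}) :
  F \in faces R -> flag_coloring R (face_flags F).
Proof.
case/imsetP=> y _ ->; apply/flag_coloringP; split=> x; rewrite /face_flags;
  congr (_%:R); congr nat_of_bool; rewrite !inE -!face_of_eq; congr (_ == _);
  apply/eqP; rewrite eq_sym face_of_eq connect1 // /boundary_step eqxx ?orbT //.
Qed.

Lemma face_sum_coloring (G : mgraph) (R : ribbon G)
    (x : 'rV['F_2]_(#|faces R|)) :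
  flag_coloring R (fun y => \sum_i x 0 i * face_flags (enum_val i) y).
Proof.
have H i := flag_coloringP _ _ (face_flags_coloring (enum_valP (i : 'I_#|faces R|))).
by apply/flag_coloringP; split=> y; apply: eq_bigr => i _; have [H1 H2] := H i;
  rewrite ?H1 ?H2.
Qed.

Lemma face_sum_jump (G : mgraph) (R : ribbon G)
    (x : 'rV['F_2]_(#|faces R|)) (j : 'I_#|edge G|) :
  (x *m face_boundaries R) 0 j =
  jump (fun y => \sum_i x 0 i * face_flags (enum_val i) y) (enum_val j, false).
Proof.
rewrite mxE /jump -big_split /=; apply: eq_bigr => i _.
by rewrite mxE /jump mulrDr.
Qed.

(** A combination of faces with zero boundary has no jumps, hence is constant by [flag_const]. *)
Lemma rank_face_boundaries (G : mgraph) (R : ribbon G) :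
  connected G -> (#|faces R| <= \rank (face_boundaries R) + 1)%N.
Proof.
move=> Gc; apply: rank_le1 => x x0.
pose f y := \sum_i x 0 i * face_flags (enum_val i) y.
have fc : forall y z, f y = f z.
  apply: (flag_const Gc (face_sum_coloring x)) => e.
  have := face_sum_jump x (enum_rank e).
  by rewrite x0 mxE enum_rankK => <-.
(* Faces are disjoint, so [f] takes the value [x 0 i] on the flags of face [i]. *)
have fE i : exists y, x 0 i = f y.
  have /imsetP[y _ yE] := enum_valP i; exists y; rewrite /f (bigD1 i) //=.
  rewrite {1}yE /face_flags {1}inE connect0 mulr1 big1 ?addr0 // => k nk.
  have /imsetP[z _ zE] := enum_valP k.
  case: (boolP (y \in _)) => yk; rewrite ?mulr0 //; case/eqP: nk.
  apply: enum_val_inj; rewrite yE zE; move: yk; rewrite zE inE -face_of_eq.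
  by move/eqP/(congr1 val).
by move=> i j; have [y ->] := fE i; have [z ->] := fE j.
Qed.

Lemma sum_incidence (G : mgraph) (z : edge G -> 'F_2) (k : 'I_#|vertex G|) :
  \sum_j z (enum_val j) * incidence G k j =
  \sum_(h : half G | base h == enum_val k) z h.1.
Proof.
rewrite [RHS]big_mkcond /= -(pair_bigA _ (fun e b =>
  if base (e, b) == enum_val k then z e else 0)) /=.
rewrite [RHS]big_enum_val /=; apply: eq_bigr => j _.
rewrite mxE mulr_sumr; apply: eq_bigr => b _.
by rewrite /base /=; case: eqP => _; rewrite ?mulr1 ?mulr0.
Qed.

(* On a sphere the cycles of the graph are the sums of face boundaries modulo
   2: boundaries are cycles, and [euler_characteristic R = 2] makes the
   dimensions agree. *)
Lemma cycle_face_potential (G : mgraph) (R : ribbon G) (z : edge G -> 'F_2) :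
  connected G -> euler_characteristic R = 2 ->
  (forall v, \sum_(h : half G | base h == v) z h.1 = 0) ->
  exists2 f : flag G -> 'F_2, flag_coloring R f &
    forall e, jump f (e, false) = z e.
Proof.
move=> Gc chi2 z0.
have rkM := rank_incidence Gc; have rkD := rank_face_boundaries R Gc.
have DM : (face_boundaries R <= kermx (incidence G)^T)%MS.
  rewrite sub_kermx; apply/eqP/matrixP=> i k; rewrite !mxE.
  under eq_bigr => j _ do rewrite mxE [X in _ * X]mxE.
  have /face_flags_coloring /flag_coloringP[fC fS] := enum_valP i.
  rewrite (sum_incidence (fun e => jump (face_flags (enum_val i)) (e, false))).
  rewrite -[RHS](sum_jump (pred1 (enum_val k)) fC).
  by apply: eq_bigr => h _; rewrite -(jump_edge h fS).
pose w : 'rV['F_2]_#|edge G| := \row_j z (enum_val j).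
have wM : (w <= kermx (incidence G)^T)%MS.
  rewrite sub_kermx; apply/eqP/rowP=> k; rewrite !mxE.
  under eq_bigr => j _ do rewrite mxE [X in _ * X]mxE.
  by rewrite sum_incidence z0.
(* The kernel has dimension at most |E| - |V| + 1, which is |F| - 1 on the sphere and so at most the
   rank of [face_boundaries R]. *)
have MD : (kermx (incidence G)^T <= face_boundaries R)%MS.
  rewrite -(geq_leqif (mxrank_leqif_sup DM)) mxrank_ker mxrank_tr.
  by move: chi2; rewrite /euler_characteristic; lia.
have /submxP[x wx] := submx_trans wM MD.
exists (fun y => \sum_i x 0 i * face_flags (enum_val i) y).
  exact: face_sum_coloring.
move=> e; have := face_sum_jump x (enum_rank e).
by rewrite -wx mxE !enum_rankK.
Qed.

(** * Signs *)

(* Run along the boundary of [half_twist R a] selected by [f]: the potential [g]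
   is constant along untwisted bands and changes by [jump g] at twisted ones. *)
Lemma sum_twisted_jumps (G : mgraph) (R : ribbon G) (a : {ffun edge G -> bool})
    (f g : flag G -> 'F_2) :
  flag_coloring (half_twist R a) f -> flag_coloring R g ->
  \sum_e (a e)%:R * (jump f (e, false) * jump g (e, false)) = 0.
Proof.
move=> /flag_coloringP[fC fS] /flag_coloringP[gC gS].
(* Disk arcs do not depend on the twists, so the product of [f] and [g] is constant along them and
   its jumps sum to zero. *)
transitivity (\sum_e \sum_b jump (fun x => f x * g x) (e, b)); last first.
  rewrite pair_bigA -[RHS](@sum_jump G R (fun x => f x * g x) predT).
    by apply: eq_big => [|[e b]].
  by move=> x; rewrite -(fC x) -(gC x).
(* If [a e] is false, the values of [f] and [g] reach the other end in the same order and the two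
   jumps cancel; otherwise one pair is exchanged, and px + qy + py + qx = (p + q)(x + y). *)
apply: eq_bigr => e _; rewrite big_bool /= /jump.
rewrite -(fS (e, true, true)) -(fS (e, true, false)).
rewrite -(gS (e, true, true)) -(gS (e, true, false)).
rewrite /side /= twisted_half_twist.
set p := f _; set q := f (e, false, true); set x := g _; set y := g _.
(* Some of the identities hold only in characteristic 2, up to twice [p * x + q * y]. *)
have add_double u v w : u + 2 * w = v -> u = v :> 'F_2 by rewrite two_F2 mul0r addr0.
case: (twisted R e); case: (a e); rewrite /= ?mul0r ?mul1r -/p -/q -/x -/y.
all: try by ring.
all: try by apply/esym/(add_double _ _ (- (p * x + q * y))); ring.
Qed.

Lemma sum_delta2 (n : nat) (F : 'I_n -> 'I_n -> 'F_2) (a b : 'I_n) :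
  \sum_i \sum_j F i j * ((a == i)%:R * (b == j)%:R) = F a b.
Proof.
rewrite (bigD1 a) //= [X in _ + X]big1 ?addr0; last first.
  move=> i /negbTE na; apply: big1 => j _.
  by rewrite eq_sym na mul0r mulr0.
rewrite (bigD1 b) //= !eqxx !mulr1 big1 ?addr0 // => j /negbTE nb.
by rewrite [b == j]eq_sym nb !mulr0.
Qed.

Lemma F2_nat_eq0 (n : nat) : (n%:R == 0 :> 'F_2) = ~~ odd n.
Proof. by rewrite -val_eqE /= val_Fp_nat // modn2; case: (odd n). Qed.

(* Pushed slightly into the faces of the plane ribbon graph [R], the boundaries
   of the faces of color [i] and those of color [j] cross exactly on the twisted
   bands with sides colored [i] and [j], and closed curves on a sphere cross an
   even number of times. *)
Lemma plane_coloring_even (G : mgraph) (R : ribbon G)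
    (a : {ffun edge G -> bool}) (n : nat) (c : flag G -> 'I_n) :
  connected G -> euler_characteristic R = 2 ->
  flag_coloring (half_twist R a) c -> proper_coloring c ->
  ~~ odd (num_twists a).
Proof.
move=> Gc chi2 /flag_coloringP[cC cS] /forallP cP.
pose f (i : 'I_n) (x : flag G) : 'F_2 := (c x == i)%:R.
have fP i : flag_coloring (half_twist R a) (f i).
  by apply/flag_coloringP; split=> x; rewrite /f ?cC ?cS.
have cross0 i j :
    \sum_e (a e)%:R * (jump (f i) (e, false) * jump (f j) (e, false)) = 0.
  have /flag_coloringP[fC fS] := fP j.
  (* The boundary of the faces of color [j] is a cycle of [G], hence on the plane [R] also the jump
     of a potential [g]. *)
  have [|g gP gj] :=
      @cycle_face_potential G R (fun e => jump (f j) (e, false)) Gc chi2.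
    move=> v; rewrite -[RHS](@sum_jump G R (f j) (pred1 v)) //.
    by apply: eq_bigr => h _; rewrite -(jump_edge h fS).
  under eq_bigr => e _ do rewrite -gj.
  exact: sum_twisted_jumps (fP i) gP.
rewrite -F2_nat_eq0 /num_twists natr_sum; apply/eqP.
(* Over the pairs of colors [i < j], each twisted edge is counted exactly once, for the colors of
   its two sides. *)
transitivity (\sum_(i : 'I_n) \sum_(j : 'I_n) (i < j)%:R *
    \sum_e (a e)%:R * (jump (f i) (e, false) * jump (f j) (e, false))); last first.
  by rewrite big1 // => i _; rewrite big1 // => j _; rewrite cross0 mulr0.
under [RHS]eq_bigr => i _ do (under eq_bigr => j _ do rewrite mulr_sumr;
  rewrite exchange_big /=).
rewrite exchange_big /=; apply: eq_bigr => e _.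
rewrite -[LHS]mulr1.
transitivity ((a e)%:R * \sum_(i : 'I_n) \sum_(j : 'I_n)
  ((i < j)%:R * (jump (f i) (e, false) * jump (f j) (e, false)))); last first.
  rewrite mulr_sumr; apply: eq_bigr => i _; rewrite mulr_sumr.
  by apply: eq_bigr => j _; ring.
congr (_ * _); pose F (i j : 'I_n) : 'F_2 := (i < j)%:R.
set p := c (e, false, false); set q := c (e, false, true).
have npq : p != q by exact: cP.
(* Each jump is a sum of two Kronecker deltas, at [p] and at [q], so the product picks out four
   values of [F]; only the one at the increasing pair is 1. *)
transitivity (F p p + F p q + F q p + F q q).
  rewrite /F !ltnn add0r addr0; case: ltngtP => pq; rewrite ?addr0 ?add0r //.
  by move/val_inj: pq npq => ->; rewrite eqxx.
rewrite -!(sum_delta2 F) -!big_split; apply: eq_bigr => i _.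
rewrite -!big_split; apply: eq_bigr => j _ /=.
by rewrite /jump /f -/p -/q /F; ring.
Qed.

(** * Polynomials and their values at natural numbers *)

Lemma poly_eventually_pos (p : {poly int}) :
  0 < lead_coef p -> exists N, forall n, (N <= n)%N -> 0 < p.[n%:R].
Proof.
elim/poly_ind: p => [|p c IH]; first by rewrite lead_coef0.
have [->|p0] := eqVneq p 0.
  rewrite mul0r add0r lead_coefC => c0; exists 0%N => n _; by rewrite hornerC.
rewrite lead_coefDl ?lead_coefMX; last first.
  rewrite size_polyC size_mulX //; apply: leq_ltn_trans (leq_b1 _) _.
  by rewrite ltnS size_poly_gt0.
(* Beyond this bound the integer [p.[n%:R]] is at least 1 and [n] exceeds the absolute value of
   [c]. *)
case/IH=> N HN; exists (N + `|c|.+1)%N => n Nn; rewrite hornerMXaddC.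
have : 0 < p.[n%:R] by apply: HN; lia.
have : `|c|%N%:Z < n%:R by lia.
move: (p.[_]) => x; nia.
Qed.

Lemma poly_nat_ge0 (p : {poly int}) :
  (forall n, 0 <= p.[n%:R]) -> 0 <= lead_coef p.
Proof.
move=> p0; rewrite leNgt; apply/negP; rewrite -oppr_gt0 -lead_coefN.
case/poly_eventually_pos=> N /(_ N (leqnn N)).
by rewrite hornerN oppr_gt0 ltNge p0.
Qed.

Lemma poly_nat_eq0 (p : {poly int}) : (forall n, p.[n%:R] = 0) -> p = 0.
Proof.
move=> p0; apply/eqP; rewrite -lead_coef_eq0 eq_le.
rewrite -oppr_ge0 -lead_coefN !poly_nat_ge0 // => n;
  by rewrite ?hornerN p0 ?oppr0.
Qed.

(** * The Penrose polynomial of a graph as a sum over ribbon graphs *)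

Lemma nonnegative_ribbonE (G : mgraph) (R : ribbon G) :
  nonnegative_ribbon R = (0 <= lead_coef (penrose R)).
Proof.
rewrite /nonnegative_ribbon /positive_ribbon /zero_ribbon le_eqVlt.
rewrite [0 == _]eq_sym lead_coef_eq0 orbC.
by case: eqP => //= ->; rewrite lead_coef0.
Qed.

(** Up to equivalence [S] is [half_twist R b], and shifting the summation index by [b] multiplies
    every sign by that of [b]. *)
Lemma penrose_sign (G : mgraph) (R S : ribbon G) :
  trivalent G -> exists s : bool, penrose R = (-1) ^+ s *: penrose S.
Proof.
move=> G3; have [b [u bRS]] := exists_vertex_flip G3 R S.
exists (odd (num_twists b)); rewrite signr_odd.
apply/eqP; rewrite -subr_eq0; apply/eqP/poly_nat_eq0 => n.
rewrite hornerD hornerN hornerZ !penrose_coloring; apply/eqP; rewrite subr_eq0.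
apply/eqP; rewrite (reindex_inj (can_inj (@add_twistK G b))) mulr_sumr.
apply: eq_bigr => a _; rewrite sign_num_twists_add [_ * (-1) ^+ num_twists b]mulrC.
rewrite -mulrA; congr (_ * (_ * _%:R)); apply: num_face_colorings_equiv.
have := vertex_flip_half_twist a bRS.
have -> : add_twist a b = add_twist b a.
  by apply/ffunP=> e; rewrite !ffunE addbC.
exact: vertex_flip_equiv.
Qed.

Lemma graph_penroseE (G : mgraph) (R : ribbon G) :
  trivalent G -> nonnegative_ribbon R -> graph_penrose G = penrose R.
Proof.
move=> G3 Rge0; rewrite /graph_penrose; case: pickP => [S Sge0|/(_ R)]; last first.
  by rewrite Rge0.
have [[]] := penrose_sign S R G3; rewrite /= ?expr0 ?expr1 ?scale1r ?scaleN1r //.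
move=> E.
(* With opposite signs, both leading coefficients can be nonnegative only if they vanish. *)
move: Sge0 Rge0; rewrite !nonnegative_ribbonE E lead_coefN oppr_ge0 => le ge.
suff /eqP -> : penrose R == 0 by rewrite oppr0.
by rewrite -lead_coef_eq0 eq_le le ge.
Qed.

(** The weight [w] has to match the sign only where colorings exist; this covers both the parity
    signs and, for a plane [R], the constant weight 1. *)
Lemma sum_representatives_twists (G : mgraph) (R : ribbon G)
    (T : {set ribbon G}) (n : nat) (w : ribbon G -> int) :
  trivalent G -> trivial_automorphism_group G ->
  represents_all_ribbon_graphs T ->
  (loopless G -> forall a S, ribbon_equiv (half_twist R a) S ->
     num_face_colorings (half_twist R a) n != 0%N ->
     w S = (-1) ^+ num_twists a) ->
  (penrose R).[n%:R] = \sum_(S in T) w S * (num_face_colorings S n)%:R.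
Proof.
move=> G3 Gtriv Trep wP; rewrite penrose_coloring.
have [noloop|loop] := boolP (loopless G); last first.
  by rewrite !big1 // => S _; rewrite loop_no_coloring // mulr0.
rewrite (sum_representatives G3 R
  (F := fun S => w S * (num_face_colorings S n)%:R) Gtriv noloop Trep).
  apply: eq_bigr => a _; have [->|nz] := eqVneq (num_face_colorings (half_twist R a) n) 0%N.
    by rewrite !mulr0.
  by rewrite (wP noloop a _ (ribbon_equiv_refl _)).
move=> S S' SS'; have [a aP] := twist_class G3 R S Gtriv noloop.
have aS : ribbon_equiv (half_twist R a) S by rewrite aP.
have aS' : ribbon_equiv (half_twist R a) S'.
  by rewrite (ribbon_equiv_left _ aS).
rewrite -(num_face_colorings_equiv n aS) -(num_face_colorings_equiv n aS').
have [->|nz] := eqVneq (num_face_colorings (half_twist R a) n) 0%N.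
  by rewrite !mulr0.
by rewrite !(wP noloop a).
Qed.
Lemma graph_penrose_even_odd (G : mgraph) (Gamma : ribbon G)
    (T : {set ribbon G}) (n : nat) :
  trivalent G -> trivial_automorphism_group G -> nonnegative_ribbon Gamma ->
  represents_all_ribbon_graphs T ->
  (graph_penrose G).[n%:R] =
    (\sum_(R in T | even_ribbon Gamma R) num_face_colorings R n)%N%:Z -
    (\sum_(R in T | odd_ribbon Gamma R) num_face_colorings R n)%N%:Z.
Proof.
move=> G3 Gtriv Gge0 Trep; rewrite (graph_penroseE G3 Gge0).
rewrite (sum_representatives_twists
  (w := fun S => (-1) ^+ odd_ribbon Gamma S) G3 Gtriv Trep).
  rewrite -!natz !natr_sum (bigID (even_ribbon Gamma)) /= -sumrN.
  congr (_ + _); apply: eq_bigr => S /andP[_]; rewrite /odd_ribbon.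
    by move=> ->; rewrite mul1r.
  by move=> /negbTE ->; rewrite expr1 mulN1r.
move=> noloop a S aS _.
by rewrite /odd_ribbon (even_ribbon_twist G3 Gtriv noloop aS) negbK signr_odd.
Qed.

(** The polynomial can be computed from the plane ribbon graph [R]: all nonzero terms of its
    coloring expansion have sign 1, so [R] is nonnegative. *)
Lemma graph_penrose_planar (G : mgraph) (T : {set ribbon G}) (n : nat) :
  connected G -> trivalent G -> trivial_automorphism_group G ->
  represents_all_ribbon_graphs T -> planar G ->
  (graph_penrose G).[n%:R] = (\sum_(R in T) num_face_colorings R n)%N%:Z.
Proof.
move=> Gc G3 Gtriv Trep [R chi2].
have even_twists m a : num_face_colorings (half_twist R a) m != 0%N ->
    (-1) ^+ num_twists a = 1 :> int.
  rewrite -lt0n num_face_coloringsE => /card_gt0P[c]; rewrite inE.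
  case/andP=> cP cproper; rewrite -signr_odd.
  by rewrite (negbTE (plane_coloring_even Gc chi2 cP cproper)).
have Rge0 : nonnegative_ribbon R.
  rewrite nonnegative_ribbonE; apply: poly_nat_ge0 => m.
  rewrite penrose_coloring; apply: sumr_ge0 => a _.
  have [->|/even_twists ->] := eqVneq (num_face_colorings (half_twist R a) m) 0%N.
    by rewrite mulr0.
  by rewrite mul1r.
rewrite (graph_penroseE G3 Rge0).
rewrite (sum_representatives_twists (w := fun=> 1) G3 Gtriv Trep).
  by rewrite -natz natr_sum; apply: eq_bigr => S _; rewrite mul1r.
by move=> _ a S _ /even_twists ->.
Qed.
End Proof.

Theorem theoremE (G : mgraph) (Gamma : ribbon G) (T : {set ribbon G}) :
  connected G -> trivalent G -> trivial_automorphism_group G ->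
  nonnegative_ribbon Gamma ->
  represents_all_ribbon_graphs T ->
  (forall n : nat,
     (graph_penrose G).[n%:R]%R =
       ((\sum_(R in T | even_ribbon Gamma R) num_face_colorings R n)%N%:Z
        - (\sum_(R in T | odd_ribbon Gamma R) num_face_colorings R n)%N%:Z)%R)
  /\ (planar G -> forall n : nat,
     (graph_penrose G).[n%:R]%R =
       ((\sum_(R in T) num_face_colorings R n)%N%:Z)%R).
Proof.
move=> Gc G3 Gtriv Gge0 Trep; split=> [n|Gplanar n].
  exact: graph_penrose_even_odd.
exact: graph_penrose_planar.
Qed.
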